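(* Let $X$ and $Y$ be independent random variables, a.s. strictly positive, with $\operatorname{ess\,sup}X=\operatorname{ess\,sup}Y=+\infty$. Let $C_Y,\alpha>0$ be constants. Suppose $\overline F_Y(u)\sim C_Yu^{-\alpha}$ as $u\to\infty$, and $\overline F_X$ satisfies the conditions $(\mathrm C_\alpha)$ and $(\mathrm D_\alpha)$. Then, as $u\to\infty$, $$\overline F_{XY}(u)\sim C_Y\,\mathbb E[X^{\alpha}]\,u^{-\alpha}.$$
   Context: All limits are as $u\to\infty$; $a(u)\sim b(u)$ means $a(u)/b(u)\to1$. For a random variable $Z$, $\overline F_Z(u):=\mathbb P\{Z>u\}$ (regarded as a function on $\mathbb R_+:=[0,\infty)$ below). $\operatorname{ess\,sup}Z$ is the smallest $C\in\mathbb R$ with $Z\le C$ a.s., or $+\infty$ if no such $C$ exists. $\mathcal M$ is the class of functions $f:\mathbb R_+\to\mathbb R_+$ that are nonincreasing on $[u_0,\infty)$ for some $u_0>0$ and satisfy $f(u)\to0$. Let $f\in\mathcal M$ and $\alpha>0$. $f$ satisfies $(\mathrm C_\alpha)$ if there exists $\varphi:\mathbb R_+\to\mathbb R_+$ such that $\varphi(u)\to\infty$, $\varphi(u)/u\to0$ and $f(\varphi(u))=o(u^{-\alpha})$. $f$ satisfies $(\mathrm D_\alpha)$ if $f(u)=o(u^{-\alpha})$ and $\int_0^\infty f(u)u^{\alpha-1}\,du<\infty$. *)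

(* Defs.v *)
From HB Require Import structures.
From mathcomp Require Import all_boot all_order all_algebra.
From mathcomp Require Import all_classical all_reals all_analysis.
From mathcomp Require Import ess_sup_inf.

Set Implicit Arguments.
Unset Strict Implicit.
Unset Printing Implicit Defensive.

Import Order.TTheory GRing.Theory Num.Theory.
Import numFieldNormedType.Exports.

Local Open Scope classical_set_scope.
Local Open Scope ring_scope.

(* A function from [0, +oo[ to [0, +oo[ is represented by a total function on R
   that is nonnegative on [0, +oo[; its values on ]-oo, 0[ are irrelevant. *)
Definition nneg_fun (R : realType) (f : R -> R) : Prop :=
  forall u, 0 <= u -> 0 <= f u.

Record classM (R : realType) := ClassM {
  classM_fun :> R -> R;
  classM_nneg : nneg_fun classM_fun;
  classM_noninc : exists2 u0 : R, 0 < u0 &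
    {in `[u0, +oo[ &, nonincreasing_fun classM_fun};
  classM_cvg0 : classM_fun u @[u --> +oo] --> 0
}.

(* Makes Landau's little-o available along u --> +oo. *)
Canonical pinfty_filter_on (R : numFieldType) :=
  FilterType (pinfty_nbhs R) (@filter_filter _ _ (@proper_pinfty_nbhs R)).

Definition condC (R : realType) (alpha : R) (f : classM R) : Prop :=
  exists phi : R -> R,
    [/\ nneg_fun phi,
        phi u @[u --> +oo] --> +oo,
        phi u / u @[u --> +oo] --> 0 &
        (fun u : R => f (phi u)) =o_+oo (fun u : R => u `^ (- alpha))].

(* Integrability includes measurability of the integrand, which membership in
   the class alone does not guarantee near 0. *)
Definition condD (R : realType) (alpha : R) (f : classM R) : Prop :=
  (f : R -> R) =o_+oo (fun u : R => u `^ (- alpha)) /\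
  (@lebesgue_measure R).-integrable `[0, +oo[
    (fun u : R => (f u * u `^ (alpha - 1))%:E).

Definition asymp_equiv (R : realType) (a b : R -> R) : Prop :=
  a u / b u @[u --> +oo] --> (1 : R).

Definition indep_rv (d : measure_display) (T : measurableType d)
    (R : realType) (P : probability T R) (X Y : {RV P >-> R}) : Prop :=
  forall A B : set R, measurable A -> measurable B ->
    P ((X @^-1` A) `&` (Y @^-1` B)) = (P (X @^-1` A) * P (Y @^-1` B))%E.

Definition surv (d : measure_display) (T : measurableType d) (R : realType)
    (P : probability T R) (Z : T -> R) (u : R) : R :=
  fine (P [set w | u < Z w]).

Section survival.
Context {d : measure_display} {T : measurableType d} {R : realType}.
Context {P : probability T R}.

Lemma surv_ccdf (Z : {RV P >-> R}) (u : R) : surv P Z u = fine (ccdf Z u).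
Proof.
by rewrite /surv /ccdf /distribution /pushforward set_itvoy.
Qed.

Lemma surv_nneg (Z : {RV P >-> R}) : nneg_fun (surv P Z).
Proof. by move=> u _; rewrite /surv fine_ge0// measure_ge0. Qed.

Lemma surv_noninc (Z : {RV P >-> R}) : exists2 u0 : R, 0 < u0 &
  {in `[u0, +oo[ &, nonincreasing_fun (surv P Z)}.
Proof.
exists 1 => // x y _ _ xy; rewrite !surv_ccdf.
apply: fine_le; [exact: fin_num_measure..|exact: ccdf_nonincreasing].
Qed.

Lemma surv_cvg0 (Z : {RV P >-> R}) : surv P Z u @[u --> +oo] --> 0.
Proof.
rewrite (_ : surv P Z = fine \o ccdf Z).
  exact: fine_cvg (@cvg_ccdfy0 _ _ _ P Z).
by apply/funext => u; exact: surv_ccdf.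
Qed.

Definition survM (Z : {RV P >-> R}) : classM R :=
  ClassM (@surv_nneg Z) (@surv_noninc Z) (@surv_cvg0 Z).

End survival.

(* Main.v *)
From HB Require Import structures.
Require Import Defs.
From mathcomp Require Import all_boot all_order all_algebra.
From mathcomp Require Import all_classical all_reals all_analysis.
From mathcomp Require Import ess_sup_inf measurable_realfun.
From mathcomp Require Import ring.
Import Order.TTheory GRing.Theory Num.Theory.
Import numFieldNormedType.Exports.
Local Open Scope classical_set_scope.
Local Open Scope ring_scope.

(** Condition on X. By independence,
      u^alpha P{X Y > u} = E[(u/X)^alpha F_Y(u/X) X^alpha],
    where F_Y is the tail of Y. For X > 0 fixed, u/X tends to infinity, so the
    integrand tends to C_Y X^alpha. Moreover v^alpha F_Y(v) is bounded by some K
    on the whole of ]0, +oo[ ([powR_mul_bounded]), so the integrand is dominated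
    by K X^alpha. As soon as E[X^alpha] is finite, dominated convergence gives
    the limit C_Y E[X^alpha] ([surv_mul_powR_cvg]).

    Finiteness of E[X^alpha] is what the integrability in [condD] provides:
    x^alpha is at most a constant times the integral of u^(alpha-1) over
    [0, x[ ([powR_le_integral]), and Tonelli's theorem turns the expectation of
    that integral into the integral of P{X > u} u^(alpha-1)
    ([moment_le_integral_surv]). Positivity of E[X^alpha], needed to divide by
    it, comes from X > 0 almost surely. *)

(** A tail asymptotic to C u^(-alpha) gives a bound valid for all v > 0, not
    only for large v: for v below a threshold M1, F v <= 1 and v^alpha is at
    most M1^alpha. *)
Lemma powR_mul_bounded (R : realType) (F : R -> R) (C alpha : R) :
  0 < C -> 0 < alpha -> (forall v, 0 <= F v <= 1) ->
  asymp_equiv F (fun u => C * u `^ (- alpha)) ->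
  exists K, forall v, 0 < v -> F v * v `^ alpha <= K.
Proof.
move=> C0 a0 F01 /cvgr_lt/(_ 2 (ltr1n _ 2)) -[M [Mr HM]].
pose M1 := Num.max M 1.
exists (Num.max (2 * C) (M1 `^ alpha)).
move=> v v0; rewrite le_max; have [vM|Mv] := leP v M1; apply/orP.
- right; have /andP[F0 F1] := F01 v.
  rewrite -[leRHS]mul1r ler_pM ?powR_ge0//.
  by rewrite ge0_ler_powR ?nnegrE ?(ltW a0) ?(ltW v0)// (le_trans (ltW v0)).
- left; have := HM v; rewrite /= (le_lt_trans _ Mv) ?le_max ?lexx// => /(_ isT).
  have va : 0 < v `^ alpha by exact: powR_gt0.
  by rewrite powRN ltr_pdivrMr ?divr_gt0// mulrA ltr_pdivlMr// => /ltW.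
Qed.

(** A one-sided substitute for the exact value x^a / a of the integral of
    u^(a-1) over [0, x[. Keeping only the interval [x/2, x[, where
    u^(a-1) = u^a / u >= (x/2)^a / x, costs a constant factor but needs neither
    a primitive nor an improper integral at 0 when a < 1. *)
Lemma powR_le_integral (R : realType) (x a : R) : 0 < x -> 0 < a ->
  ((x `^ a)%:E <= (2 * 2 `^ a)%:E * \int[@lebesgue_measure R]_u
     (\1_`[0%R, +oo[ u * (\1_[set v | v < x] u * u `^ (a - 1)))%:E)%E.
Proof.
move=> x0 a0; set mu := lebesgue_measure.
have x20 : 0 < x / 2 by rewrite divr_gt0.
pose g (u : measurableTypeR R) :=
  \1_`[0%R, +oo[ u * (\1_[set v | v < x] u * u `^ (a - 1)).
have mf : measurable_fun [set: measurableTypeR R] (EFin \o g).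
  apply/measurable_EFinP; apply: measurable_funM => //.
  apply: measurable_funM; last exact: measurable_powR.
  apply: measurable_indic; rewrite -set_itvNyo; exact: measurable_itv.
have : (\int[mu]_(u in `[(x / 2)%R, x[) cst ((x / 2) `^ a / x)%:E u <=
   \int[mu]_u (\1_`[0%R, +oo[ u * (\1_[set v | v < x] u * u `^ (a - 1)))%:E)%E.
  apply: (@le_trans _ _ (\int[mu]_(u in `[(x / 2)%R, x[)
      (\1_`[0%R, +oo[ u * (\1_[set v | v < x] u * u `^ (a - 1)))%:E)%E).
    apply: ge0_le_integral => //.
    - by move=> u _; rewrite lee_fin divr_ge0 ?powR_ge0// ltW.
    - exact: measurable_funTS.
    move=> u /=; rewrite in_itv/= => /andP[xu ux].
    have u0 : 0 < u by exact: lt_le_trans xu.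
    rewrite !indicE !mem_set//=; last by rewrite in_itv/= ltW.
    rewrite !mul1r lee_fin powRB ?(gt_eqF u0) ?implybT// powRr1 ?(ltW u0)//.
    apply: ler_pM; rewrite ?powR_ge0 ?invr_ge0 ?(ltW x0)//.
      by rewrite ge0_ler_powR ?nnegrE ?(ltW a0) ?(ltW u0) ?(ltW x20).
    by rewrite lef_pV2 ?posrE// ltW.
  apply: ge0_subset_integral => //.
  by move=> u _; rewrite lee_fin !mulr_ge0 ?powR_ge0.
rewrite integral_cst//= /mu lebesgue_measure_itv/= lte_fin ifT; last first.
  by rewrite ltr_pdivrMr// ltr_pMr// ltr1n.
move=> H; have k0 : (0 <= (2 * 2 `^ a)%:E :> \bar R)%E.
  by rewrite lee_fin mulr_ge0 ?powR_ge0.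
apply: le_trans (lee_wpmul2l k0 H).
rewrite -EFinB -!EFinM lee_fin.
have {1}-> : x = 2 * (x / 2) by field.
rewrite powRM ?(ltW x20)// le_eqVlt; apply/orP; left; apply/eqP.
by field; rewrite gt_eqF.
Qed.

Section tail_of_product.
Context {d : measure_display} {T : measurableType d} {R : realType}.
Context {P : probability T R}.

Lemma measurable_rv_gt (X : {RV P >-> R}) (u : R) :
  measurable [set w | u < X w].
Proof.
rewrite (_ : [set w | u < X w] = X @^-1` `]u, +oo[%classic).
  by rewrite -[X in measurable X]setTI; exact: measurable_funPT.
by apply/seteqP; split => w; rewrite /= in_itv/= andbT.
Qed.

(** The law of (X, Y) is the product of the marginal laws, and its value at A
    is the integral of the sections of A. *)
Lemma indep_rv_xsection (X Y : {RV P >-> R}) (A : set (R * R)) :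
  indep_rv X Y -> measurable A ->
  P [set w | A (X w, Y w)] = (\int[P]_w distribution P Y (xsection A (X w)))%E.
Proof.
move=> XY mA.
have mXY : measurable_fun [set: T] (fun w => (X w, Y w)).
  exact: measurable_fun_pair.
pose mXYm := isMeasurableFun.Build _ _ _ _ _ mXY.
pose Z : {mfun T >-> (R * R)%type} :=
  HB.pack (fun w => (X w, Y w)) mXYm.
(* The law of (X, Y) agrees with the product measure on rectangles. *)
have ZE B C : measurable B -> measurable C ->
    distribution P Z (B `*` C) = (distribution P X B * distribution P Y C)%E.
  by move=> mB mC; rewrite -XY.
rewrite -[LHS]/(distribution P Z A) -(product_measure_unique ZE)//.
rewrite /product_measure1 ge0_integral_distribution//.
  exact: measurable_fun_xsection.
Qed.

(** The a-th moment is controlled by the tail integral that appears in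
    [condD]: the bound of [powR_le_integral] is integrated over the sample space
    and Tonelli's theorem exchanges the two integrals. *)
Lemma moment_le_integral_surv (X : {RV P >-> R}) (a : R) : 0 < a ->
  {ae P, forall w, 0 < X w} ->
  (\int[P]_w (X w `^ a)%:E <= (2 * 2 `^ a)%:E *
    \int[@lebesgue_measure R]_(u in `[0%R, +oo[)
      (surv P X u * u `^ (a - 1))%:E)%E.
Proof.
move=> a0 X0.
pose A := [set p : T * measurableTypeR R | p.2 < X p.1].
(* The integral of h over u bounds X^a; its integral over the sample space is
   u^(a-1) P{X > u} on [0, +oo[. *)
pose h (p : T * measurableTypeR R) :=
  (\1_`[0%R, +oo[ p.2 * (\1_A p * p.2 `^ (a - 1)))%:E.
have h0 p : (0 <= h p)%E by rewrite lee_fin !mulr_ge0 ?powR_ge0.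
have mA : measurable A.
  have : measurable_fun setT (fun p : T * measurableTypeR R => p.2 < X p.1).
    by apply: measurable_fun_ltr => //; apply: measurableT_comp.
  by move=> /(_ measurableT [set true]); rewrite setTI; exact.
have mh : measurable_fun [set: T * measurableTypeR R] h.
  apply/measurable_EFinP; apply: measurable_funM => //=.
    by apply: measurableT_comp => //; exact: measurable_indic.
  apply: measurable_funM; first exact: measurable_indic.
  exact: (measurableT_comp (measurable_powR _)).
apply: (@le_trans _ _
  (\int[P]_w ((2 * 2 `^ a)%:E * \int[lebesgue_measure]_u h (w, u)))%E).
  apply: ae_ge0_le_integral => //.
  - by move=> w _; rewrite lee_fin powR_ge0.
  - by apply/measurable_EFinP; apply: (measurableT_comp (measurable_powR _)).
  - by move=> w _; rewrite mule_ge0 ?integral_ge0// lee_fin mulr_ge0 ?powR_ge0.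
  - apply: measurable_funeM.
    exact: measurable_fun_fubini_tonelli_F.
  apply: filterS X0 => w Xw _; exact: powR_le_integral.
rewrite ge0_integralZl_EFin//; last 2 first.
- by move=> w _; exact: integral_ge0.
- exact: measurable_fun_fubini_tonelli_F.
rewrite fubini_tonelli// [X in (_ <= _ * X)%E]integral_mkcond.
rewrite lee_pmul2l ?lte_fin ?mulr_gt0 ?powR_gt0//.
rewrite le_eqVlt; apply/orP; left; apply/eqP; apply: eq_integral => u _.
rewrite patchE /h; case: ifPn => uD.
  under eq_integral.
    move=> w _; rewrite indicE/= uD mul1r mulrC EFinM; over.
  rewrite ge0_integralZl_EFin ?powR_ge0//; last first.
    by apply/measurable_EFinP; apply: measurableT_comp (measurable_indic mA) _.
  have mXu := measurable_rv_gt X u.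
  rewrite mulrC EFinM; congr (_ * _)%E.
  rewrite /surv fineK ?fin_num_measure//.
  rewrite -[X in P X]setIT -integral_indic//.
by under eq_integral do rewrite indicE/= (negbTE uD) mul0r; rewrite integral0.
Qed.

(** Breiman's lemma when v^a P{Y > v} is bounded on the whole half-line: this
    boundedness makes K X^a a dominating function, so integrability of X^a is
    the only condition on X. *)
Lemma surv_mul_powR_cvg (X Y : {RV P >-> R}) (C K a : R) : 0 < a ->
  indep_rv X Y -> {ae P, forall w, 0 < X w} ->
  P.-integrable [set: T] (fun w => (X w `^ a)%:E) ->
  (forall v, 0 < v -> surv P Y v * v `^ a <= K) ->
  surv P Y v * v `^ a @[v --> +oo] --> C ->
  surv P (X \* Y) u * u `^ a @[u --> +oo] -->
    C * fine ('E_P[fun w => X w `^ a]).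
Proof.
move=> a0 XY X0 iX FK FC; apply/cvg_pinftyP => u uy.
(* The domination needs positive arguments, hence the truncation at 1, which
   changes only finitely many terms. *)
pose v n := Num.max (u n) 1.
have v0 n : 0 < v n by rewrite /v lt_max ltr01 orbT.
have uv : \forall n \near \oo, u n = v n.
  move/cvgryPge : uy => /(_ 1); apply: filterS => n u1.
  by rewrite /v max_l.
have vy : v n @[n --> \oo] --> +oo.
  by apply: cvg_trans uy; apply: near_eq_cvg; exact: uv.
pose A n := [set p : R * R | v n < p.1 * p.2].
have mA n : measurable (A n).
  have : measurable_fun setT (fun p : R * R => v n < p.1 * p.2).
    by apply: measurable_fun_ltr => //; exact: measurable_funM.
  by move=> /(_ measurableT [set true]); rewrite setTI; exact.
(* By independence, v_n^a P{X Y > v_n} is the integral of f n. *)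
pose f n w := ((v n `^ a)%:E * distribution P Y (xsection (A n) (X w)))%E.
have fE n w : 0 < X w ->
    f n w = (surv P Y (v n / X w) * (v n / X w) `^ a * X w `^ a)%:E.
  move=> Xw; rewrite /f -mulrA -powRM ?divr_ge0 ?(ltW (v0 n)) ?(ltW Xw)//.
  rewrite divfK ?gt_eqF// mulrC EFinM; congr (_ * _)%E.
  have mY := measurable_rv_gt Y (v n / X w).
  rewrite /surv fineK ?fin_num_measure//; congr (P _).
  apply/seteqP; split => z /=; rewrite /xsection/= inE /A/=.
    by rewrite ltr_pdivrMr// mulrC.
  by rewrite ltr_pdivrMr// mulrC.
have mf n : measurable_fun [set: T] (f n).
  apply: measurable_funeM.
  apply: (measurableT_comp (measurable_fun_xsection (distribution P Y) (mA n))).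
  exact: measurable_funPT.
have mXa : measurable_fun [set: T] (fun w => (X w `^ a)%:E).
  by case/integrableP : iX.
have f_cvg : {ae P, forall w, [set: T] w ->
    f n w @[n --> \oo] --> (C%:E * (X w `^ a)%:E)%E}.
  apply: filterS X0 => w Xw _; rewrite (funext (fun n => fE n w Xw)) -EFinM.
  apply: cvg_EFin; first exact: nearW.
  apply: cvgMr_tmp; move/cvg_pinftyP : FC; apply.
  move/cvgryPge : vy => vy; apply/cvgryPge => B.
  by apply: filterS (vy (B * X w)) => n; rewrite ler_pdivlMr.
have f_le : {ae P, forall w, forall n, [set: T] w ->
    (`|f n w| <= K%:E * (X w `^ a)%:E)%E}.
  apply: filterS X0 => w Xw n _; rewrite fE//= lee_fin ger0_norm.
    by rewrite ler_wpM2r ?powR_ge0// FK ?divr_gt0.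
  by rewrite !mulr_ge0 ?powR_ge0// fine_ge0.
have [_ _] := dominated_convergence measurableT mf (measurable_funeM _ mXa)
  f_cvg (integrableZl measurableT K iX) f_le.
rewrite integralZl// => /= fcvg.
move: fcvg; rewrite -(fineK (integrable_fin_num measurableT iX)) -EFinM.
move=> /fine_cvg fcvg; rewrite unlock; apply: cvg_trans fcvg.
apply: near_eq_cvg; apply: filterS uv => n /= ->.
rewrite ge0_integralZl_EFin ?powR_ge0//; last first.
  apply: (measurableT_comp (measurable_fun_xsection (distribution P Y) (mA n))).
  exact: measurable_funPT.
rewrite -indep_rv_xsection// fineM//; last first.
  apply: fin_num_measure; rewrite -[X in measurable X]setTI.
  have mXY : measurable_fun [set: T] (fun w => (X w, Y w)).
    exact: measurable_fun_pair.
  exact: mXY.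
by rewrite mulrC.
Qed.

End tail_of_product.

Theorem theorem4 (d : measure_display) (T : measurableType d) (R : realType)
    (P : probability T R) (X Y : {RV P >-> R}) (C_Y alpha : R)
    (hC : 0 < C_Y) (halpha : 0 < alpha)
    (hindep : indep_rv X Y)
    (hX0 : {ae P, forall w, 0 < X w}) (hY0 : {ae P, forall w, 0 < Y w})
    (hXsup : ess_sup P (EFin \o X) = +oo%E)
    (hYsup : ess_sup P (EFin \o Y) = +oo%E)
    (hY : asymp_equiv (surv P Y) (fun u => C_Y * u `^ (- alpha)))
    (hXC : condC alpha (survM X)) (hXD : condD alpha (survM X)) :
  asymp_equiv (surv P (X \* Y))
    (fun u => C_Y * fine ('E_P[fun w : T => X w `^ alpha]) * u `^ (- alpha)).
Proof.
have mXa : measurable_fun [set: T] (fun w => (X w `^ alpha)%:E).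
  by apply/measurable_EFinP; apply: (measurableT_comp (measurable_powR _)).
have iX : P.-integrable [set: T] (fun w => (X w `^ alpha)%:E).
  apply/integrableP; split=> //.
  under eq_integral do rewrite abse_EFin ger0_norm ?powR_ge0//.
  apply: le_lt_trans (moment_le_integral_surv X _ halpha hX0) _.
  rewrite lte_mul_pinfty ?lee_fin ?mulr_ge0 ?powR_ge0//.
  exact: integrable_lty hXD.2.
have E0 : 0 < fine 'E_P[fun w => X w `^ alpha].
  rewrite unlock fine_gt0// [X in (_ < X)%E](_ : _ = \int[P]_w (X w `^ alpha)%:E)%E//.
  rewrite integrable_lty// andbT lt_neqAle eq_sym integral_ge0; last first.
    by move=> w _; rewrite lee_fin powR_ge0.
  (* A vanishing expectation would force X^alpha = 0 almost everywhere. *)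
  rewrite andbT; apply/eqP => EX0.
  have /(ae_eq_integral_abs P measurableT mXa) Xa0 :
      (\int[P]_w `|(X w `^ alpha)%:E| = 0)%E.
    by under eq_integral do rewrite abse_EFin ger0_norm ?powR_ge0//.
  have PT : ProperFilter (almost_everywhere P).
    by apply: ae_properfilter_algebraOfSetsType; rewrite /= probability_setT.
  have [w [Xw /(_ Logic.I) [Xw0]]] := filter_ex (filterI hX0 Xa0).
  by have := powR_gt0 alpha Xw; rewrite Xw0 ltxx.
have F01 v : 0 <= surv P Y v <= 1.
  rewrite surv_ccdf fine_ge0//= -lee_fin fineK ?probability_le1//.
  exact: fin_num_measure.
have [K FK] := powR_mul_bounded _ _ _ _ hC halpha F01 hY.
have FC : surv P Y v * v `^ alpha @[v --> +oo] --> C_Y.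
  rewrite -[C_Y]mul1r.
  apply: cvg_trans (cvgMr_tmp (b := C_Y) hY); apply: near_eq_cvg.
  near=> v; rewrite powRN.
  have v0 : 0 < v by near: v; exact: nbhs_pinfty_gt.
  by field; rewrite !gt_eqF ?powR_gt0.
have := surv_mul_powR_cvg _ _ _ _ _ halpha hindep hX0 iX FK FC.
move: E0; set E := fine _ => E0 /(cvgMr_tmp (b := (C_Y * E)^-1)).
rewrite divff ?gt_eqF ?mulr_gt0// => XYE.
apply: cvg_trans XYE; apply: near_eq_cvg.
near=> v; rewrite powRN.
have v0 : 0 < v by near: v; exact: nbhs_pinfty_gt.
by field; rewrite !gt_eqF ?powR_gt0.
Unshelve. all: by end_near.
Qed.
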